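(* Let $(X,\sigma,\tau)$ be a non-degenerate solution. Define maps $U,T,\hat U,\hat T\colon X\to X$ by $$U(x)=\sigma_x^{-1}(x),\qquad T(x)=\tau_x^{-1}(x),\qquad \hat T(x)=\sigma_{T(x)}(x)=\sigma_{\tau_x^{-1}(x)}(x),\qquad \hat U(x)=\tau_{U(x)}(x)=\tau_{\sigma_x^{-1}(x)}(x).$$ Then $\hat T$ and $U$ are mutually inverse, and $\hat U$ and $T$ are mutually inverse; that is, $\hat T U=U\hat T=\mathrm{id}_X$ and $\hat U T=T\hat U=\mathrm{id}_X$.
   Context: A (set-theoretic) solution (of the Yang-Baxter equation) $(X,\sigma,\tau)$ is a set $X$ (of arbitrary cardinality) with maps $\sigma,\tau\colon X^2\to X$ such that, writing $\sigma_x(y)=\sigma(x,y)$ and $\tau_y(x)=\tau(x,y)$, the map $r\colon X^2\to X^2$, $r(x,y)=(\sigma_x(y),\tau_y(x))$ satisfies the braid relation $(\mathrm{id}\times r)(r\times \mathrm{id})(\mathrm{id}\times r)=(r\times \mathrm{id})(\mathrm{id}\times r)(r\times \mathrm{id})$ on $X^3$. It is left non-degenerate if all $\sigma_x$ ($x\in X$) are bijections of $X$, right non-degenerate if all $\tau_y$ ($y\in X$) are bijections of $X$, and non-degenerate if it is both. The map $r$ is not assumed to be bijective. *)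

(* Defs.v *)
From mathcomp Require Import all_boot.
From mathcomp Require Import boolp classical_sets functions.

Set Implicit Arguments.
Unset Strict Implicit.
Unset Printing Implicit Defensive.

Section YangBaxter.
Variable X : Type.

(* Both maps are curried in the order of the arguments of sigma(x, y) and
   tau(x, y): sigma_x is [sigma x] and tau_y is [tau^~ y]. *)
Variables sigma tau : X -> X -> X.

Definition ybe_map (p : X * X) : X * X := (sigma p.1 p.2, tau p.1 p.2).

Definition id_times (r : X * X -> X * X) (t : X * X * X) : X * X * X :=
  let: (x, y, z) := t in (x, (r (y, z)).1, (r (y, z)).2).

Definition times_id (r : X * X -> X * X) (t : X * X * X) : X * X * X :=
  (r t.1, t.2).

Definition yb_solution : Prop :=
  let r := ybe_map in
  id_times r \o times_id r \o id_times r =1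
  times_id r \o id_times r \o times_id r.

Definition left_nondegenerate : Prop := forall x, bijective (sigma x).

Definition right_nondegenerate : Prop := forall y, bijective (tau^~ y).

Definition nondegenerate : Prop := left_nondegenerate /\ right_nondegenerate.

(* The library's pseudo-inverse is the two-sided inverse of a bijection; its
   default function (here the identity) only matters outside the range. *)
Definition inverse (f : X -> X) : X -> X := 'pinv_id [set: X] f.

Definition U (x : X) : X := inverse (sigma x) x.

Definition T (x : X) : X := inverse (tau^~ x) x.

Definition T_hat (x : X) : X := sigma (T x) x.

Definition U_hat (x : X) : X := tau x (U x).

End YangBaxter.

Lemma inverseK (X : Type) (f : X -> X) : bijective f -> cancel f (inverse f).
Proof.
move=> /bij_inj finj x; apply: pinvKV; last by rewrite inE.
by move=> ? ? _ _ /finj.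
Qed.

Lemma inverseVK (X : Type) (f : X -> X) : bijective f -> cancel (inverse f) f.
Proof.
by move=> fbij; have [g _ gK] := fbij => x; rewrite -{1}[x]gK inverseK ?gK.
Qed.

(* Main.v *)
(* Write r(x, y) = (sigma_x y, tau_y x), so that r(x, U x) = (x, U_hat x) and
   r(T x, x) = (T_hat x, x). The braid relation quickly gives T U_hat = id, so
   U_hat is injective. It also gives
   U_hat (sigma_a b) = sigma_{tau_b a} (U_hat b), and that U_hat T commutes with
   every sigma_e. Hence the first component of r(a, b) determines U_hat b, and so
   b, once the second is known: r is injective, and solving for b shows that r is
   surjective. Pulling (T_hat x, x, U_hat x) back along the two sides of the
   braid relation then shows r(T x, U (T x)) = (T x, x), that is U_hat T = id.
   The statements on T_hat and U follow by exchanging sigma and tau. *)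
Require Import Defs.
From mathcomp Require Import all_boot.

Section NondegenerateSolution.
Variables (X : Type) (sigma tau : X -> X -> X).
Hypothesis yb : yb_solution sigma tau.
Hypothesis nondeg : nondegenerate sigma tau.

Local Notation U := (U sigma).
Local Notation T := (T tau).
Local Notation T_hat := (T_hat sigma tau).
Local Notation U_hat := (U_hat sigma tau).

Lemma sigma_inj x : injective (sigma x).
Proof. exact: bij_inj (nondeg.1 x). Qed.

Lemma tau_inj y : injective (tau^~ y).
Proof. exact: bij_inj (nondeg.2 y). Qed.

Lemma sigma_surj x z : exists y, sigma x y = z.
Proof. by have [g _ gK] := nondeg.1 x; exists (g z). Qed.

Lemma tau_surj y z : exists x, tau x y = z.
Proof. by have [g _ gK] := nondeg.2 y; exists (g z); apply: gK. Qed.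

Lemma braid_sigma x y z :
  sigma x (sigma y z) = sigma (sigma x y) (sigma (tau x y) z).
Proof. by case: (yb (x, y, z)). Qed.

Lemma braid_sigma_tau x y z :
  sigma (tau x (sigma y z)) (tau y z) = tau (sigma x y) (sigma (tau x y) z).
Proof. by case: (yb (x, y, z)). Qed.

Lemma braid_tau x y z :
  tau (tau x (sigma y z)) (tau y z) = tau (tau x y) z.
Proof. by case: (yb (x, y, z)). Qed.

Lemma sigma_U x : sigma x (U x) = x.
Proof. exact: (inverseVK (nondeg.1 x)). Qed.

Lemma tau_T x : tau (T x) x = x.
Proof. exact: (inverseVK (nondeg.2 x)). Qed.

Lemma U_eq x y : sigma x y = x -> U x = y.
Proof. by move=> xy; apply: (@sigma_inj x); rewrite sigma_U. Qed.

Lemma T_eq x y : tau y x = x -> T x = y.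
Proof. by move=> yx; apply: (@tau_inj x); rewrite /= tau_T. Qed.

(** This is the third component of the braid relation at [(y, x, U x)], where [tau y x] runs over
    all of [X]. *)
Lemma tau_U_hat w x : tau w (U_hat x) = tau w (U x).
Proof.
by have [y <-] := tau_surj x w; rewrite -(braid_tau y x (U x)) sigma_U.
Qed.

Lemma tau_T_hat w x : tau w (T_hat x) = tau w (T x).
Proof.
by apply: (@tau_inj x); rewrite /= -(braid_tau w (T x) x) tau_T.
Qed.

Lemma U_hatK : cancel U_hat T.
Proof. by move=> x; apply: T_eq; rewrite tau_U_hat. Qed.

Lemma U_sigma a b : U (sigma a b) = sigma (tau a b) (U b).
Proof. by apply: U_eq; rewrite -braid_sigma sigma_U. Qed.

Lemma U_hat_sigma a b : U_hat (sigma a b) = sigma (tau a b) (U_hat b).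
Proof. by rewrite /Defs.U_hat U_sigma -braid_sigma_tau sigma_U. Qed.

Lemma T_sigma m d : T (sigma (tau m (T d)) d) = sigma m (T d).
Proof.
by apply: T_eq; rewrite -braid_sigma_tau -/(T_hat d) tau_T_hat tau_T.
Qed.

Lemma U_hat_T_sigma e d : U_hat (T (sigma e d)) = sigma e (U_hat (T d)).
Proof.
by have [m <-] := tau_surj (T d) e; rewrite T_sigma U_hat_sigma.
Qed.

Lemma ybe_map_inj a b a' b' :
  sigma a b = sigma a' b' -> tau a b = tau a' b' -> a = a' /\ b = b'.
Proof.
move=> eq_sigma eq_tau.
have eqb : b = b'.
  apply: (can_inj U_hatK); apply: (@sigma_inj (tau a b)).
  by rewrite -U_hat_sigma eq_sigma eq_tau U_hat_sigma.
by split=> //; apply: (@tau_inj b); rewrite /= eq_tau eqb.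
Qed.

Lemma ybe_map_surj e h : exists a b, sigma a b = e /\ tau a b = h.
Proof.
(* This choice gives [T (sigma h z) = T (U_hat e) = e]. *)
have [z zE] := sigma_surj h (U_hat e).
have [a aE] := tau_surj (T z) h.
exists a, (T z); split=> //; apply: (can_inj U_hatK).
by rewrite U_hat_sigma aE -U_hat_T_sigma zE U_hatK.
Qed.

Lemma TK : cancel T U_hat.
Proof.
move=> x; have [m [n [mnT mnx]]] := ybe_map_surj (T x) x.
(* One side of the braid relation sends [(m, n, U x)] to [(T_hat x, x, U_hat x)]; on the other side,
   injectivity of r cancels r(x, U x) = (x, U_hat x). *)
have [eq_s eq_x] : sigma m (sigma n (U x)) = T_hat x /\ tau m (sigma n (U x)) = x.
  have := braid_tau m n (U x); have := braid_sigma_tau m n (U x).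
  rewrite braid_sigma mnT mnx sigma_U tau_T => eq2 eq3; split=> //.
  by have [] := @ybe_map_inj _ _ x (U x) (etrans eq2 (esym (sigma_U x))) eq3.
have [mT _] := @ybe_map_inj _ _ (T x) x eq_s (etrans eq_x (esym (tau_T x))).
by rewrite mT in mnT mnx; rewrite /Defs.U_hat (U_eq _ _ mnT).
Qed.

End NondegenerateSolution.

(** Conjugation by the flip reverses triples and swaps the two sides of the braid relation. It
    exchanges [U] with [T] and [U_hat] with [T_hat]. *)
Lemma yb_solution_mirror (X : Type) (sigma tau : X -> X -> X) :
  yb_solution sigma tau ->
  yb_solution (fun x y => tau y x) (fun x y => sigma y x).
Proof.
move=> yb r [[x y] z]; have [e1 e2 e3] := yb (z, y, x).
by rewrite /r /times_id /= -e1 -e3 -e2.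
Qed.

Theorem theorem3p3 (X : Type) (sigma tau : X -> X -> X) :
  yb_solution sigma tau -> nondegenerate sigma tau ->
  (cancel (U sigma) (T_hat sigma tau) /\ cancel (T_hat sigma tau) (U sigma)) /\
  (cancel (T tau) (U_hat sigma tau) /\ cancel (U_hat sigma tau) (T tau)).
Proof.
move=> yb nd; have yb' := yb_solution_mirror _ _ _ yb.
have nd' : nondegenerate (fun x y => tau y x) (fun x y => sigma y x).
  by split=> x; [apply: nd.2 | apply: nd.1].
split; split.
- exact: (TK _ _ _ yb' nd').
- exact: (U_hatK _ _ _ yb' nd').
- exact: TK.
- exact: U_hatK.
Qed.
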